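(* Suppose that $X$ is a real-valued random variable with $\mathbb{E}[X]=0$ and $\mathbb{E}[X^{2}]=2b^{2}\in(0,\infty)$ (with $b>0$), and let $X^{L}$ be a random variable, defined on the same probability space as $X$, having the centered equilibrium distribution with respect to $X$. Then \[ d_{BL}(\mathscr{L}(X),\mathrm{Laplace}(0,b))\leq\frac{b+2}{b}\,\mathbb{E}\left|X-X^{L}\right|. \]
   Context: $\mathscr{L}(X)$ denotes the distribution (law) of $X$. For $b>0$, $\mathrm{Laplace}(0,b)$ is the probability distribution on $\mathbb{R}$ with density $w\mapsto\frac{1}{2b}e^{-|w|/b}$. The bounded Lipschitz distance is $d_{BL}(\mathscr{L}(X),\mathscr{L}(Y))=\sup_{h\in\mathcal{H}_{BL}}|\mathbb{E}[h(X)]-\mathbb{E}[h(Y)]|$, where $\mathcal{H}_{BL}$ is the set of $h:\mathbb{R}\to\mathbb{R}$ with $\|h\|_{\infty}\leq1$ and $|h(x)-h(y)|\leq|x-y|$ for all $x,y\in\mathbb{R}$. For a nondegenerate random variable $X$ with mean zero and finite variance, a random variable $X^{L}$ is said to have the centered equilibrium distribution with respect to $X$ if $\mathbb{E}[f(X)]-f(0)=\frac{1}{2}\mathbb{E}[X^{2}]\,\mathbb{E}[f''(X^{L})]$ for all twice-differentiable functions $f:\mathbb{R}\to\mathbb{R}$ such that $f$, $f'$ and $f''$ are bounded. *)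

(* Defs.v *)
From HB Require Import structures.
From mathcomp Require Import all_boot all_order all_algebra.
From mathcomp Require Import all_classical all_reals all_analysis measurable_realfun.

Set Implicit Arguments.
Unset Strict Implicit.
Unset Printing Implicit Defensive.

Import Order.TTheory GRing.Theory Num.Theory.
Import numFieldNormedType.Exports.

Local Open Scope classical_set_scope.
Local Open Scope ring_scope.

Definition laplace_pdf {R : realType} (b w : R) : R :=
  (2 * b)^-1 * expR (- `|w| / b).

(* The proof of [0 < b] is an argument so that the probability structure on
   [laplace_prob b0] can be inferred. Lebesgue measure is declared on
   [measurableTypeR R]; here the Borel sigma-algebra is the one carried by [R]
   itself (same sets, other display), so that [laplace_prob b0] has the same
   type as [distribution P X] for [X : {RV P >-> R}]. *)
Definition laplace_prob {R : realType} (b : R) (b0 : 0 < b)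
    : set R -> \bar R :=
  fun A => (\int[lebesgue_measure]_(w in A) (laplace_pdf b w)%:E)%E.

Section laplace_probability.
Context {R : realType} {b : R} (b0 : 0 < b).
Local Notation mu := (@lebesgue_measure R).

Lemma laplace_pdf_ge0 (w : R) : 0 <= laplace_pdf b w.
Proof. by rewrite mulr_ge0 ?expR_ge0// invr_ge0 mulr_ge0// ltW. Qed.

Lemma continuous_laplace_pdf : continuous (laplace_pdf b).
Proof.
move=> w; apply: cvgM; first exact: cvg_cst.
apply: (cvg_comp _ expR); last exact: continuous_expR.
apply: cvgM; last exact: cvg_cst.
by apply: cvgN; exact: norm_continuous.
Qed.

Lemma measurable_laplace_pdf : measurable_fun [set: R] (laplace_pdf b).
Proof. exact: continuous_measurable_fun continuous_laplace_pdf. Qed.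

Lemma integral_laplace_pdf : (\int[mu]_w (laplace_pdf b w)%:E = 1)%E.
Proof.
have bV : 0 < b^-1 by rewrite invr_gt0.
rewrite ge0_symfun_integralT; last 3 first.
- exact: laplace_pdf_ge0.
- exact: continuous_laplace_pdf.
- by move=> w; rewrite /= /laplace_pdf normrN.
have -> : (\int[mu]_(w in [set w | (0 <= w)%R]) (laplace_pdf b w)%:E =
           2^-1%:E * \int[mu]_w (exponential_pdf b^-1 w)%:E)%E.
  rewrite -ge0_integralZl//; last 2 first.
  - by apply/measurable_EFinP; exact: measurable_exponential_pdf.
  - by move=> w _; rewrite lee_fin exponential_pdf_ge0// ltW.
  rewrite -set_itvcy [LHS]integral_mkcond.
  apply: eq_integral => w _; rewrite patchE /exponential_pdf patchE.
  case: ifPn => [|_]; last by rewrite mule0.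
  rewrite inE /= in_itv /= andbT => w0.
  rewrite -EFinM /laplace_pdf ger0_norm// invfM mulrA mulNr.
  by rewrite [- _ * w]mulNr (mulrC b^-1 w).
by rewrite integral_exponential_pdf// mule1 -EFinM divff.
Qed.

Let laplace0 : laplace_prob b0 set0 = 0%E.
Proof. by rewrite /laplace_prob integral_set0. Qed.

Let laplace_ge0 A : (0 <= laplace_prob b0 A)%E.
Proof. by apply: integral_ge0 => w _; rewrite lee_fin laplace_pdf_ge0. Qed.

Let laplace_sigma_additive : semi_sigma_additive (laplace_prob b0 : set R -> \bar R).
Proof.
move=> /= F mF tF mUF; rewrite /laplace_prob; apply: cvg_toP.
  apply: ereal_nondecreasing_is_cvgn => m n mn.
  apply: lee_sum_nneg_natr => // k _ _; apply: integral_ge0 => /= x Fkx.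
  by rewrite lee_fin laplace_pdf_ge0.
rewrite ge0_integral_bigcup//=.
- apply/measurable_funTS/measurableT_comp => //.
  exact: measurable_laplace_pdf.
- by move=> x _; rewrite lee_fin laplace_pdf_ge0.
Qed.

HB.instance Definition _ := isMeasure.Build _ R R
  (laplace_prob b0) laplace0 laplace_ge0 laplace_sigma_additive.

Let laplace_setT : laplace_prob b0 [set: R] = 1%E.
Proof. exact: integral_laplace_pdf. Qed.

HB.instance Definition _ :=
  Measure_isProbability.Build _ R R (laplace_prob b0) laplace_setT.

End laplace_probability.

Definition H_BL (R : realType) : set (R -> R) :=
  [set h | (forall x, `|h x| <= 1) /\
           (forall x y, `|h x - h y| <= `|x - y|)].

(* For a probability [mu] on the line, ['E_mu[h]] is the expectation of [h Z]
   for any random variable [Z] of law [mu]. *)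
Definition d_BL {R : realType} (mu nu : probability R R)
    : \bar R :=
  ereal_sup [set `| 'E_mu[h] - 'E_nu[h] |%E | h in @H_BL R].

(* Only the characterizing identity: that [X] is nondegenerate and centered with
   finite variance is to be assumed separately. *)
Definition centered_equilibrium {R : realType} {d d' : measure_display}
    {T : measurableType d} {T' : measurableType d'}
    (P : probability T R) (P' : probability T' R)
    (X : {RV P >-> R}) (XL : {RV P' >-> R}) : Prop :=
  forall f : R -> R,
    (forall x, derivable f x 1) ->
    (forall x, derivable f^`()%classic x 1) ->
    bounded_fun f ->
    bounded_fun f^`()%classic ->
    bounded_fun f^`()^`()%classic ->
    ('E_P[f \o X] - (f 0)%:E =
     2^-1%:E * 'E_P[fun w => (X w ^+ 2)%R] * 'E_P'[f^`()^`()%classic \o XL])%E.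

(* Main.v *)
Require Import Defs.
From mathcomp Require Import all_boot all_order all_algebra.
From mathcomp Require Import all_classical all_reals all_analysis.
From mathcomp Require Import measurable_realfun ring lra.

Import Order.TTheory GRing.Theory Num.Theory.
Import numFieldNormedType.Exports.

Local Open Scope classical_set_scope.
Local Open Scope ring_scope.

(** The proof is Stein's method for the Laplace law. Let [Z] have the law
    Laplace(0, b), with density [p], and let [H] be a bounded 1-Lipschitz test
    function. The equation

      g - b^2 g'' = H

    has the bounded solution [g w = E (H (w + Z))], the convolution of [H] with
    [p] ([stein_solution]). In particular [g 0 = E (H Z)]
    ([stein_solution0]). Since [g], [g'] and [g''] are bounded, [g] can be used
    in the identity that characterizes [XL]; as half the second moment of [X]
    is [b^2], that identity says

      E (g X) - E (H Z) = b^2 E (g'' XL) = E ((g - H) XL),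

    and subtracting [E ((g - H) X)] on both sides gives

      E (H X) - E (H Z) = E ((g - H) XL - (g - H) X).

    It remains to estimate the Lipschitz constant of [g - H]: the function [H]
    contributes 1, and [g] contributes a bound on [g'] ([gH_lipschitz]).

    Test functions are translated so as to take values in an interval [0, M],
    with [M = 2] for a test function bounded by 1 in absolute value: adding a
    constant to [H] changes neither side. Besides allowing all integrals to be
    those of nonnegative functions, this gives a good bound on the derivative:
    [g'] is, up to the factor [1 / (2 b^2)], the difference of two one-sided
    exponential integrals of [H] that both lie in [0, M b], so
    [|g'| <= M / (2 b) = 1 / b] ([stein_solution_deriv_le]). The
    constant thus obtained is [1 + 1 / b], which is at most [(b + 2) / b]. *)

(** * Integration against the Laplace distribution *)

Section laplace_density.
Context {R : realType} {b : R} (b0 : 0 < b).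
Local Notation mu := (@lebesgue_measure R).
Import HBNNSimple.

(** By approximation from below by simple functions, on which both sides are
    computed by linearity from the definition of [laplace_prob] on sets. *)
Lemma ge0_integral_laplace_prob (f : R -> \bar R) :
  measurable_fun [set: R] f -> (forall x, 0 <= f x)%E ->
  (\int[laplace_prob b0]_x f x = \int[mu]_x (f x * (laplace_pdf b x)%:E))%E.
Proof.
move=> mf f0.
pose f_ := nnsfun_approx measurableT mf.
have mp : measurable_fun [set: R] (fun x => (laplace_pdf b x)%:E).
  by apply/measurable_EFinP; exact: measurable_laplace_pdf.
have p0 x : (0 <= (laplace_pdf b x)%:E)%E by rewrite lee_fin laplace_pdf_ge0.
have cvgf x : (EFin \o f_ ^~ x) n @[n --> \oo] --> f x.
  by apply: cvg_nnsfun_approx => // *; exact: f0.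
have mf_ n : measurable_fun [set: R] (EFin \o f_ n).
  by apply/measurable_EFinP; exact: measurable_funP.
have -> : (\int[laplace_prob b0]_x f x =
    limn (fun n => \int[laplace_prob b0]_x (f_ n x)%:E))%E.
  rewrite -monotone_convergence//.
  - by apply: eq_integral => x _; apply/esym/cvg_lim => //; exact: cvgf.
  - by move=> n x _; rewrite lee_fin.
  - by move=> x _ m n mn; rewrite lee_fin; exact/lefP/nd_nnsfun_approx.
have -> : (\int[mu]_x (f x * (laplace_pdf b x)%:E) =
    limn (fun n => \int[mu]_x ((f_ n x)%:E * (laplace_pdf b x)%:E)))%E.
  rewrite -monotone_convergence//.
  - apply: eq_integral => x _; apply/esym/cvg_lim => //.
    by apply: cvgeZr => //; exact: cvgf.
  - by move=> n; apply: emeasurable_funM; [exact: mf_|exact: mp].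
  - by move=> n x _; rewrite mule_ge0// lee_fin.
  - move=> x _ m n mn; apply: lee_wpmul2r => //.
    by rewrite lee_fin; have /lefP := nd_nnsfun_approx measurableT mf mn; exact.
congr (limn _); apply/funext => n.
have mfr r : measurable (f_ n @^-1` [set r]).
  by rewrite -(setTI (_ @^-1` _)); exact: (measurable_funP (f_ n)).
have mfi r :
    measurable_fun [set: R] (fun x => (r * \1_(f_ n @^-1` [set r]) x)%:E).
  by apply/measurable_EFinP; exact: measurable_funM.
transitivity (\sum_(r \in range (f_ n))
    \int[laplace_prob b0]_x (r * \1_(f_ n @^-1` [set r]) x)%:E)%E.
  rewrite -ge0_integral_fsum//; last first.
    by move=> r x _; rewrite nnfun_muleindic_ge0.
  by apply: eq_integral => x _; rewrite fsumEFin// -fimfunE.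
transitivity (\sum_(r \in range (f_ n)) \int[mu]_x
    ((r * \1_(f_ n @^-1` [set r]) x)%:E * (laplace_pdf b x)%:E))%E; last first.
  rewrite -ge0_integral_fsum//; last 2 first.
  - move=> r; apply: emeasurable_funM; last exact: mp.
    exact: mfi.
  - by move=> r x _; rewrite mule_ge0// nnfun_muleindic_ge0.
  apply: eq_integral => x _; rewrite -ge0_mule_fsuml => [|r]; last first.
    exact: nnfun_muleindic_ge0.
  by rewrite fsumEFin// -fimfunE.
apply: eq_fsbigr => _ /[!inE] -[x _ <-].
have r0 : 0 <= f_ n x by [].
rewrite integralZl_indic_nnsfun// integral_indic// setIT.
transitivity ((f_ n x)%:E * \int[mu]_y
    ((\1_(f_ n @^-1` [set f_ n x]) y)%:E * (laplace_pdf b y)%:E))%E.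
  congr *%E; rewrite [LHS]integral_mkcond; apply: eq_integral => y _.
  by rewrite patchE indicE; case: ifPn => _; rewrite ?mul1e ?mul0e.
rewrite -ge0_integralZl//.
- by apply: eq_integral => y _; rewrite EFinM muleA.
- apply: emeasurable_funM; last exact: mp.
  by apply/measurable_EFinP; exact: (measurable_indic (mfr _)).
- by move=> y _; rewrite mule_ge0// lee_fin.
Qed.

End laplace_density.

(** * The solution of the Stein equation *)

(** The part of the convolution of [H] with [y |-> exp (- |y| / b)] that comes
    from the half-line on the left of [w]. Splitting the convolution at [w]
    removes the absolute value and leaves an integral with moving endpoint,
    which the fundamental theorem of calculus differentiates. *)
Definition left_smoothing {R : realType} (b : R) (H : R -> R) (w : R) : R :=
  expR (- (b^-1 * w)) *
  \int[lebesgue_measure]_(y in `]-oo, w]) (expR (b^-1 * y) * H y).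

(** The convolution of [H] with the Laplace density. The part on the right of
    [w] is a left part again, after the reflection [y |-> - y]. *)
Definition stein_solution {R : realType} (b : R) (H : R -> R) (w : R) : R :=
  (2 * b)^-1 * (left_smoothing b H w + left_smoothing b (H \o -%R) (- w)).

Definition stein_solution_deriv {R : realType}
    (b : R) (H : R -> R) (w : R) : R :=
  (2 * b ^+ 2)^-1 *
    (left_smoothing b (H \o -%R) (- w) - left_smoothing b H w).

Section stein_equation.
Context {R : realType} {b : R} (b0 : 0 < b).
Local Notation mu := (@lebesgue_measure R).

#[local] Instance is_derive_expRZ (c x : R) :
  is_derive x 1 (fun y => expR (c * y)) (c * expR (c * x)).
Proof.
have -> : (fun y : R => expR (c * y)) = expR \o (c \*: id) by [].
by apply: is_derive_eq; rewrite /= mulrC; congr (_ * _); rewrite /GRing.scale /= mulr1.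
Qed.

Let continuous_expRZ (c : R) : continuous (fun y : R => expR (c * y)).
Proof.
move=> x; apply: (cvg_comp _ expR); last exact: continuous_expR.
by apply: cvgM; [exact: cvg_cst|exact: cvg_id].
Qed.

Lemma integral_expR_itvNyc (w : R) :
  (\int[mu]_(y in `]-oo, w]) (expR (b^-1 * y))%:E =
   (b * expR (b^-1 * w))%:E)%E.
Proof.
have bn0 : b != 0 by rewrite gt_eqF.
(* After a reflection the integral is evaluated with the antiderivative
   [y |-> - b exp (- y / b)], which vanishes at +oo. *)
rewrite -{1}(opprK w) ge0_integration_by_substitutionNy; last 2 first.
- by apply: continuous_subspaceT; exact: continuous_expRZ.
- by move=> x _; exact: expR_ge0.
have dF (x : R) : is_derive x 1 (fun y => - b * expR (- b^-1 * y))
    (expR (- b^-1 * x)).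
  have -> : (fun y => - b * expR (- b^-1 * y)) =
      - b \*: (fun y => expR (- b^-1 * y)) by [].
  by apply: is_derive_eq; rewrite /GRing.scale /= mulrA mulrNN divff// mul1r.
under eq_integral do rewrite /= mulrN -mulNr.
rewrite (@ge0_continuous_FTC2y _ (fun y => expR (- b^-1 * y))
  (fun y => - b * expR (- b^-1 * y)) _ 0).
- by rewrite sub0e -EFinN mulNr opprK mulrNN.
- by move=> x _; exact: expR_ge0.
- by apply: continuous_subspaceT; exact: continuous_expRZ.
- rewrite -(mulr0 (- b)); apply: cvgM; first exact: cvg_cst.
  rewrite (_ : (fun y => expR (- b^-1 * y)) =
    (fun z => expR (- z)) \o (fun z => b^-1 * z)); last first.
    by apply/funext => x /=; rewrite mulNr.
  apply: (@cvg_comp _ _ _ _ _ _ (pinfty_nbhs R)); last exact: cvgr_expR.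
  by apply: gt0_cvgMry; rewrite ?invr_gt0.
- by move=> x _; exact: ex_derive.
- apply: cvg_at_right_filter; apply: cvgM; first exact: cvg_cst.
  exact: continuous_expRZ.
- by move=> x _; rewrite derive1E; exact: derive_val.
Qed.

Section bounded_integrand.
Context {H : R -> R} {M : R} (cH : continuous H).
Hypothesis H0M : forall x, 0 <= H x <= M.

Let expRH_ge0 (y : R) : 0 <= expR (b^-1 * y) * H y.
Proof. by have /andP[? _] := H0M y; rewrite mulr_ge0// expR_ge0. Qed.

Let M_ge0 : 0 <= M.
Proof. by have /andP[/le_trans] := H0M 0; exact. Qed.

Let continuous_expRH : continuous (fun y => expR (b^-1 * y) * H y).
Proof. by move=> x; apply: cvgM; [exact: continuous_expRZ|exact: cH]. Qed.

Let le_integral_expRH (w : R) :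
  (\int[mu]_(y in `]-oo, w]) (expR (b^-1 * y) * H y)%:E <=
   (M * (b * expR (b^-1 * w)))%:E)%E.
Proof.
rewrite EFinM -integral_expR_itvNyc -ge0_integralZl//; last first.
  apply/measurable_EFinP/measurable_funTS.
  exact: continuous_measurable_fun (continuous_expRZ _).
apply: ge0_le_integral => //.
- by move=> x _; rewrite lee_fin.
- apply/measurable_EFinP/measurable_funTS.
  exact: continuous_measurable_fun continuous_expRH.
- apply/measurable_EFinP/measurable_funTS.
  apply: measurable_funM => //.
  exact: continuous_measurable_fun (continuous_expRZ _).
move=> x _; rewrite -EFinM lee_fin mulrC ler_wpM2r ?expR_ge0//.
by have /andP[] := H0M x.
Qed.

Lemma integrable_expRH (w : R) :
  mu.-integrable `]-oo, w] (EFin \o (fun y => expR (b^-1 * y) * H y)).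
Proof.
apply/integrableP; split.
  apply/measurable_EFinP/measurable_funTS.
  exact: continuous_measurable_fun continuous_expRH.
under eq_integral do rewrite /= ger0_norm//.
exact: le_lt_trans (le_integral_expRH w) (ltry _).
Qed.

(** The weights [exp (- (w - y) / b)], for [y <= w], have total mass [b]. *)
Lemma left_smoothing_ge0_le (w : R) : 0 <= left_smoothing b H w <= M * b.
Proof.
apply/andP; split.
  by rewrite mulr_ge0 ?expR_ge0// Rintegral_ge0.
rewrite /left_smoothing mulrC -ler_pdivlMr ?expR_gt0// -expRN opprK -mulrA.
rewrite -lee_fin /Rintegral fineK ?le_integral_expRH//.
exact: integrable_fin_num (integrable_expRH w).
Qed.

(** [left_smoothing b H] solves the first-order equation [u' + u / b = H]; two
    such equations, one for each side, make up the second-order Stein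
    equation. *)
Lemma is_derive_left_smoothing (w : R) :
  is_derive w 1 (left_smoothing b H) (H w - b^-1 * left_smoothing b H w).
Proof.
pose A (x : R) := \int[mu]_(y in `]-oo, x]) (expR (b^-1 * y) * H y).
have [dA A'] : derivable A w 1 /\ A^`()%classic w = expR (b^-1 * w) * H w.
  apply: (@continuous_FTC1 _ _ -oo%O _ (w + 1)).
  - by rewrite ltrDl.
  - exact: integrable_expRH.
  - by rewrite ltNyr.
  - exact: continuous_expRH.
have isdA : is_derive w 1 A (expR (b^-1 * w) * H w).
  by apply: DeriveDef => //; rewrite -derive1E.
have {1}-> : left_smoothing b H = (fun x => expR (- b^-1 * x)) * A.
  by apply/funext => x; rewrite /left_smoothing -mulNr.
apply: is_derive_eq; rewrite /GRing.scale /= mulrA -expRD.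
by rewrite mulNr addNr expR0 mul1r /left_smoothing -/(A w); congr (_ + _); ring.
Qed.

End bounded_integrand.

Let integral_laplace_pdf_itvNy0 {K : R -> R} {M : R} :
  continuous K -> (forall x, 0 <= K x <= M) ->
  (\int[mu]_(y in `]-oo, 0%R]) ((K y)%:E * (laplace_pdf b y)%:E) =
   ((2 * b)^-1 * left_smoothing b K 0)%:E)%E.
Proof.
move=> cK K0M.
have iK := integrable_expRH cK K0M 0.
rewrite /left_smoothing mulr0 oppr0 expR0 mul1r EFinM /Rintegral.
rewrite fineK; last first.
  exact: integrable_fin_num iK.
rewrite -integralZl//; apply: eq_integral => y /[!inE] /=.
rewrite in_itv/= => y0; rewrite -!EFinM /laplace_pdf ler0_norm// opprK.
by congr EFin; rewrite (mulrC b^-1); ring.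
Qed.

Let left_smoothing_comp_opp {H : R -> R} {M : R} :
  continuous H -> (forall x, 0 <= H x <= M) ->
  (forall w : R, 0 <= left_smoothing b (H \o -%R) w <= M * b) /\
  (forall w : R, is_derive w 1 (left_smoothing b (H \o -%R) \o -%R)
    (b^-1 * left_smoothing b (H \o -%R) (- w) - H w)).
Proof.
move=> cH H0M.
have cHN : continuous (H \o -%R).
  by move=> x; apply: continuous_comp; [exact: opp_continuous|exact: cH].
have HN0M x : 0 <= (H \o -%R) x <= M by exact: H0M.
split; first exact: left_smoothing_ge0_le.
move=> w; have := is_derive_left_smoothing cHN HN0M (- w) => dl.
by apply: is_derive_eq; rewrite /= opprK; ring.
Qed.

Section solution.
Context {H : R -> R} {M : R} (cH : continuous H).
Hypothesis H0M : forall x, 0 <= H x <= M.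

(** The two sides contribute [H w] with opposite signs: this is why [g] is twice
    differentiable although [H] is only continuous. *)
Lemma is_derive_stein_solution (w : R) :
  is_derive w 1 (stein_solution b H) (stein_solution_deriv b H w).
Proof.
have dl := is_derive_left_smoothing cH H0M w.
have [_ /(_ w) dr] := left_smoothing_comp_opp cH H0M.
have -> : stein_solution b H = (2 * b)^-1 \*: (left_smoothing b H +
    (left_smoothing b (H \o -%R) \o -%R)) by [].
apply: is_derive_eq; rewrite /stein_solution_deriv /GRing.scale /=.
by field; rewrite gt_eqF.
Qed.

(** The Stein equation [g - b^2 g'' = H]. *)
Lemma is_derive_stein_solution_deriv (w : R) :
  is_derive w 1 (stein_solution_deriv b H)
    (b ^- 2 * (stein_solution b H w - H w)).
Proof.
have dl := is_derive_left_smoothing cH H0M w.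
have [_ /(_ w) dr] := left_smoothing_comp_opp cH H0M.
have -> : stein_solution_deriv b H = (2 * b ^+ 2)^-1 \*:
    ((left_smoothing b (H \o -%R) \o -%R) - left_smoothing b H) by [].
apply: is_derive_eq; rewrite /stein_solution /GRing.scale /=.
by field; rewrite gt_eqF.
Qed.

Lemma stein_solution_ge0_le (w : R) : 0 <= stein_solution b H w <= M.
Proof.
have /andP[l0 lM] := left_smoothing_ge0_le cH H0M w.
have [/(_ (- w)) /andP[r0 rM] _] := left_smoothing_comp_opp cH H0M.
rewrite /stein_solution mulrC; apply/andP; split.
  by rewrite divr_ge0 ?addr_ge0// mulr_ge0// ltW.
by rewrite ler_pdivrMr ?mulr_gt0//; lra.
Qed.

(** Both one-sided parts lie in the interval [0, M b], so their difference is at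
    most [M b] in absolute value, whereas the triangle inequality would only
    give [2 M b]. *)
Lemma stein_solution_deriv_le (w : R) :
  `|stein_solution_deriv b H w| <= M / (2 * b).
Proof.
have /andP[l0 lM] := left_smoothing_ge0_le cH H0M w.
have [/(_ (- w)) /andP[r0 rM] _] := left_smoothing_comp_opp cH H0M.
have -> : M / (2 * b) = (2 * b ^+ 2)^-1 * (M * b).
  by field; rewrite gt_eqF.
have c0 : 0 < (2 * b ^+ 2)^-1 by rewrite invr_gt0 mulr_gt0// exprn_gt0.
rewrite /stein_solution_deriv normrM gtr0_norm// ler_pM2l// ler_norml.
by apply/andP; split; lra.
Qed.

Lemma continuous_stein_solution : continuous (stein_solution b H).
Proof.
move=> w; have dw := is_derive_stein_solution w.
by apply: differentiable_continuous; apply/derivable1_diffP; exact: ex_derive.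
Qed.

Lemma stein_solution_lipschitz (x y : R) :
  `|stein_solution b H x - stein_solution b H y| <= M / (2 * b) * `|x - y|.
Proof.
wlog xy : x y / y <= x.
  move=> wl; have [|/ltW] := leP y x; first exact: wl.
  by rewrite distrC (distrC x); exact: wl.
have [z _ ->] := @MVT_segment _ _ _ _ _ xy
    (fun z _ => is_derive_stein_solution z)
    (continuous_subspaceT continuous_stein_solution).
by rewrite normrM ler_wpM2r// stein_solution_deriv_le.
Qed.

(** This is how the Laplace law enters the bound: in the characterizing
    identity of [XL], the value at 0 of the test function is [E (H Z)]. *)
Lemma stein_solution0 :
  (stein_solution b H 0)%:E = (\int[laplace_prob b0]_x (H x)%:E)%E.
Proof.
have mH : measurable_fun [set: R] H by exact: continuous_measurable_fun.
have H0 x : 0 <= H x by have /andP[] := H0M x.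
rewrite ge0_integral_laplace_prob; last 2 first.
- exact/measurable_EFinP.
- by move=> x; rewrite lee_fin.
have cHN : continuous (H \o -%R).
  by move=> x; apply: continuous_comp; [exact: opp_continuous|exact: cH].
have HN0M x : 0 <= (H \o -%R) x <= M by exact: H0M.
set f := fun x => ((H x)%:E * (laplace_pdf b x)%:E)%E.
have f0 x : (0 <= f x)%E by rewrite /f -EFinM lee_fin mulr_ge0// laplace_pdf_ge0.
have mf : measurable_fun [set: R] f.
  apply: emeasurable_funM; apply/measurable_EFinP => //.
  exact: measurable_laplace_pdf.
rewrite -(setUv `]-oo, 0%R]%classic) ge0_integral_setU//; last 4 first.
- exact: measurableC.
- by rewrite setUv.
- by move=> x _; exact: f0.
- exact/disj_setPCl.
rewrite setCitvl integral_itv_obnd_cbnd; last exact: measurable_funTS.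
rewrite ge0_integration_by_substitution0//.
under [X in (_ + X)%E]eq_integral.
  move=> x _; rewrite /f /laplace_pdf normrN -/(laplace_pdf b x).
  over.
rewrite (integral_laplace_pdf_itvNy0 cH H0M).
rewrite (integral_laplace_pdf_itvNy0 cHN HN0M).
by rewrite -EFinD /stein_solution oppr0 mulrDr.
Qed.

End solution.

End stein_equation.

(** * Bounded and Lipschitz functions *)

Lemma continuous_lipschitz1 {R : realType} {h : R -> R} :
  (forall x y, `|h x - h y| <= `|x - y|) -> continuous h.
Proof.
move=> lip_h x; apply/cvgrPdist_lt => e e0; near=> y.
by rewrite (le_lt_trans (lip_h _ _)).
Unshelve. all: by end_near. Qed.

Lemma le_bounded_fun {T : Type} {R : realType} (f : T -> R) (K : R) :
  (forall x, `|f x| <= K) -> bounded_fun f.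
Proof.
move=> fK; exists K; split => [|L KL t _]; first exact: num_real.
exact: le_trans (fK t) (ltW KL).
Qed.

Section bounded_expectation.
Context {R : realType} {d : measure_display} {T : measurableType d}.
Variable P : probability T R.

Lemma integrable_bounded (Y : T -> R) (K : R) :
  measurable_fun [set: T] Y -> (forall t, `|Y t| <= K) ->
  P.-integrable [set: T] (EFin \o Y).
Proof.
move=> mY YK; apply: measurable_bounded_integrable => //.
  exact: le_lt_trans (probability_le1 P measurableT) (ltry 1).
exact: le_bounded_fun YK.
Qed.

End bounded_expectation.

(** * The bound for one test function *)

Section stein_method.
Context {R : realType} {d : measure_display} {T : measurableType d}.
Context {P : probability T R} {X XL : {RV P >-> R}} {b : R} (b0 : 0 < b).
Hypothesis EX2 : ('E_P[fun w => (X w ^+ 2)%R] = (2 * b ^+ 2)%:E)%E.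
Hypothesis hXL : centered_equilibrium X XL.

Section test_function.
Context {H : R -> R} {M : R} (H0M : forall x, 0 <= H x <= M).
Hypothesis lipH : forall x y, `|H x - H y| <= `|x - y|.
Local Notation g := (stein_solution b H).

Let cH : continuous H := continuous_lipschitz1 lipH.

Let g' : g^`()%classic = stein_solution_deriv b H.
Proof.
apply/funext => w; have dw := is_derive_stein_solution b0 cH H0M w.
by rewrite derive1E derive_val.
Qed.

Let g'' : g^`()^`()%classic = fun w => b ^- 2 * (g w - H w).
Proof.
apply/funext => w; have dw := is_derive_stein_solution_deriv b0 cH H0M w.
by rewrite g' derive1E derive_val.
Qed.

Let gH_bounded (x : R) : `|g x - H x| <= M.
Proof.
have /andP[? ?] := H0M x; have /andP[? ?] := stein_solution_ge0_le b0 cH H0M x.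
by rewrite ler_norml; apply/andP; split; lra.
Qed.

Let g_bounded (x : R) : `|g x| <= M.
Proof.
by have /andP[? ?] := stein_solution_ge0_le b0 cH H0M x; rewrite ger0_norm.
Qed.

Let H_bounded (x : R) : `|H x| <= M.
Proof. by have /andP[? ?] := H0M x; rewrite ger0_norm. Qed.

Let comp_integrable (f : R -> R) (Y : {RV P >-> R}) : continuous f ->
  (forall x, `|f x| <= M) -> P.-integrable [set: T] (fun t => (f (Y t))%:E).
Proof.
move=> cf fM; have mfY : measurable_fun [set: T] (f \o Y).
  by apply: measurableT_comp => //; exact: continuous_measurable_fun.
exact: (integrable_bounded P _ M mfY (fun t => fM (Y t))).
Qed.

Let cg : continuous g.
Proof. exact (continuous_stein_solution b0 cH H0M). Qed.

Let cgH : continuous (fun x => g x - H x).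
Proof. by move=> x; apply: cvgB; [exact: cg|exact: cH]. Qed.

(** The identity that characterizes [XL], applied to [g], with [g''] replaced by
    its value [b^-2 (g - H)]. *)
Let stein_identity :
  (\int[P]_t (g (X t))%:E - (g 0)%:E = \int[P]_t (g (XL t) - H (XL t))%:E)%E.
Proof.
have := hXL g; rewrite EX2 unlock => ->.
- rewrite g'' -EFinM.
  (* Half the second moment of [X] cancels the factor [b^-2] of [g'']. *)
  rewrite -[RHS]mul1e.
  have -> : (1 = (2^-1 * (2 * b ^+ 2))%:E * (b ^- 2)%:E :> \bar R)%E.
    by rewrite -EFinM; congr EFin; field; rewrite gt_eqF.
  rewrite -muleA; congr *%E; rewrite -integralZl//.
  exact: (comp_integrable _ XL cgH).
- move=> x.
  exact: (@ex_derive _ _ _ _ _ _ _ (is_derive_stein_solution b0 cH H0M x)).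
- move=> x; rewrite g'.
  exact: (@ex_derive _ _ _ _ _ _ _ (is_derive_stein_solution_deriv b0 cH H0M x)).
- exact: le_bounded_fun g_bounded.
- by rewrite g'; exact: le_bounded_fun (stein_solution_deriv_le b0 cH H0M).
- rewrite g''; apply: (@le_bounded_fun _ _ _ (b ^- 2 * M)) => x.
  have b20 : 0 <= b ^- 2 by rewrite invr_ge0 exprn_ge0// ltW.
  by rewrite normrM ger0_norm// ler_wpM2l.
Qed.

Let gH_lipschitz (x y : R) :
  `|(g x - H x) - (g y - H y)| <= (1 + M / (2 * b)) * `|x - y|.
Proof.
have -> : (g x - H x) - (g y - H y) = (g x - g y) - (H x - H y) by ring.
rewrite mulrDl mul1r [leRHS]addrC; apply: le_trans (ler_normB _ _) _.
by apply: lerD; [exact (stein_solution_lipschitz b0 cH H0M x y)|exact: lipH].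
Qed.

Lemma expectation_laplace_le :
  (`| 'E_(distribution P X)[H] - 'E_(laplace_prob b0)[H] | <=
   (1 + M / (2 * b))%:E * 'E_P[fun t => `|X t - XL t|%R])%E.
Proof.
have iH := comp_integrable _ X cH H_bounded.
have ig := comp_integrable _ X cg g_bounded.
have iX := comp_integrable _ X cgH gH_bounded.
have iXL := comp_integrable _ XL cgH gH_bounded.
have M0 : 0 <= M := le_trans (normr_ge0 _) (H_bounded 0).
rewrite unlock -(stein_solution0 b0 cH H0M) integral_distribution//; last first.
  by apply/measurable_EFinP; exact (continuous_measurable_fun cH).
have -> : (\int[P]_t (EFin \o H \o X) t - (g 0)%:E =
    \int[P]_t ((g (XL t) - H (XL t)) - (g (X t) - H (X t)))%:E)%E.
  rewrite integralB_EFin// [X in (_ = _ - X)%E]integralB_EFin// -stein_identity.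
  have /fineK <- := integrable_fin_num measurableT ig.
  have /fineK <- := integrable_fin_num measurableT iH.
  by rewrite -!EFinB; congr EFin; ring.
rewrite -ge0_integralZl//; last 2 first.
- by apply/measurable_EFinP; apply: measurableT_comp => //; exact: measurable_funB.
- by rewrite lee_fin addr_ge0// divr_ge0// mulr_ge0// ltW.
apply: le_trans (le_abse_integral _ _ _) _ => //.
  by have /integrableP[] := integrableB measurableT iXL iX.
apply: ge0_le_integral => //.
- apply: measurableT_comp => //.
  by have /integrableP[] := integrableB measurableT iXL iX.
- apply: emeasurable_funM => //.
  by apply/measurable_EFinP; apply: measurableT_comp => //; exact: measurable_funB.
- by move=> t _ /=; rewrite -EFinM lee_fin distrC gH_lipschitz.
Qed.

End test_function.
End stein_method.

(** * The bounded Lipschitz distance *)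

Theorem theorem1p2 (R : realType) (d : measure_display) (T : measurableType d)
    (P : probability T R) (X XL : {RV P >-> R}) (b : R) (b0 : 0 < b)
    (EX : ('E_P[X] = 0)%E)
    (EX2 : ('E_P[fun w => (X w ^+ 2)%R] = (2 * b ^+ 2)%:E)%E)
    (hXL : centered_equilibrium X XL) :
  (d_BL (distribution P X) (laplace_prob b0)
   <= ((b + 2) / b)%:E * 'E_P[fun w => `|X w - XL w|%R])%E.
Proof.
apply: ge_ereal_sup => _ [h [h1 lip_h] <-].
have mh : measurable_fun [set: R] h.
  exact (continuous_measurable_fun (continuous_lipschitz1 lip_h)).
have ih (mu : probability R R) : mu.-integrable [set: R] (EFin \o h).
  exact: integrable_bounded mu h 1 mh h1.
(* The translation by 1 brings the values of [h] into [0, 2]. *)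
have shift (mu : probability R R) :
    ('E_mu[fun x => (h x + 1)%R] = 'E_mu[h] + 1)%E.
  rewrite unlock (@integralD_EFin _ _ _ mu _ measurableT h (cst 1))//.
    by congr +%E; have := expectation_cst mu 1; rewrite unlock.
  exact: ih.
  exact: finite_measure_integrable_cst.
have fin_h (mu : probability R R) : ('E_mu[h])%E \is a fin_num.
  by rewrite unlock; exact (integrable_fin_num measurableT (ih mu)).
have -> : ('E_(distribution P X)[h] - 'E_(laplace_prob b0)[h] =
   'E_(distribution P X)[fun x => (h x + 1)%R] -
   'E_(laplace_prob b0)[fun x => (h x + 1)%R])%E.
  rewrite !shift -(fineK (fin_h (distribution P X))).
  rewrite -(fineK (fin_h (laplace_prob b0))).
  by rewrite -EFinB -!EFinD; congr EFin; ring.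
have lip_H x y : `|(h x + 1) - (h y + 1)| <= `|x - y|.
  by rewrite opprD addrACA subrr addr0.
have H02 x : 0 <= h x + 1 <= 2.
  have := h1 x; rewrite ler_norml => /andP[? ?].
  by apply/andP; split; lra.
apply: le_trans (expectation_laplace_le b0 EX2 hXL H02 lip_H) _.
apply: lee_wpmul2r.
  by apply: expectation_ge0 => t.
rewrite lee_fin [leRHS]mulrDl divff ?gt_eqF// lerD2l ler_pM2l//.
by rewrite lef_pV2 ?posrE ?mulr_gt0//; lra.
Qed.
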